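(* Let $\mathcal R$ be a noncommutative ring with identity, let $n$ and $s_1,\dots,s_n$ be positive integers, and let $m=\sum_{j=1}^n s_j$. Let $M\in\mathcal R^{m\times m}$ be a block upper triangular matrix $$M=\begin{bmatrix} M_{11} & \cdots & M_{1n}\\ & \ddots & \vdots\\ & & M_{nn}\end{bmatrix},$$ where $M_{jk}\in\mathcal R^{s_j\times s_k}$ for $1\le j\le k\le n$ and all blocks $M_{jk}$ with $j>k$ are zero. If each diagonal block $M_{kk}$ is invertible in the ring $\mathcal R^{s_k\times s_k}$ ($k=1,\dots,n$), then $M$ is invertible in the ring $\mathcal R^{m\times m}$. In this case, writing $M^{-1}=(M^{[-]}_{jk})_{j,k=1}^n$ with $M^{[-]}_{jk}\in\mathcal R^{s_j\times s_k}$, one has $$M^{[-]}_{jk}=\begin{cases} -M_{jj}^{-1}\cdot\left|M^{(j,j+1)}_{[k-j]}\right|\cdot M_{kk}^{-1}, & j=1,\dots,k-1,\\ M_{kk}^{-1}, & j=k,\\ 0, & j=k+1,\dots,n,\end{cases}$$ where $0$ denotes the zero matrix in $\mathcal R^{s_j\times s_k}$, $M^{(j,j+1)}_{[k-j]}$ is the block submatrix of $M$ formed by block rows $j,\dots,k-1$ and block columns $j+1,\dots,k$, and $|\cdot|$ is the Hessenberg quasideterminant.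
   Context: $\mathcal R^{p\times q}$ denotes the set of $p\times q$ matrices over $\mathcal R$. Block submatrices: for a block matrix $M=[M_{jk}]_{j,k=1}^n$ and $1\le v\le v+r-1\le n$, $1\le w\le w+r-1\le n$, $M^{(v,w)}_{[r]}$ denotes the block submatrix with block rows $v,\dots,v+r-1$ and block columns $w,\dots,w+r-1$. Hessenberg quasideterminant: let $r\ge 1$ and let $$H=\begin{bmatrix} A_{01} & \cdots & A_{0,r-1} & A_{0r}\\ A_{11} & \cdots & A_{1,r-1} & A_{1r}\\ & \ddots & \vdots & \vdots\\ & & A_{r-1,r-1} & A_{r-1,r}\end{bmatrix}$$ be a block upper Hessenberg matrix (block rows indexed $0,\dots,r-1$, block columns indexed $1,\dots,r$, blocks $A_{ab}$ with $a>b$ equal to zero), where $A_{ab}\in\mathcal R^{t_a\times t_b}$ for positive integers $t_0,\dots,t_r$, and $A_{11},\dots,A_{r-1,r-1}$ are invertible. Its Hessenberg quasideterminant is $$|H|=A_{0r}-[A_{01},\dots,A_{0,r-1}]\begin{bmatrix} A_{11} & \cdots & A_{1,r-1}\\ & \ddots & \vdots\\ & & A_{r-1,r-1}\end{bmatrix}^{-1}\begin{bmatrix} A_{1r}\\ \vdots\\ A_{r-1,r}\end{bmatrix}\in\mathcal R^{t_0\times t_r},$$ and $|H|=A_{01}$ when $r=1$. For $j<k$, the matrix $M^{(j,j+1)}_{[k-j]}$ is of this form with $r=k-j$, $A_{ab}=M_{j+a,j+b}$ and $t_a=s_{j+a}$. *)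

(* Defs.v *)
From mathcomp Require Import all_boot all_algebra.
From mathcomp Require Import boolp classical_sets.

Set Implicit Arguments.
Unset Strict Implicit.
Unset Printing Implicit Defensive.

Import GRing.Theory.
Local Open Scope ring_scope.

(* [unitmx] and [invmx] need a commutative ring of coefficients, so two-sided
   inverses are defined here over an arbitrary one.  The two dimensions are kept
   apart because row and column sizes of a square submatrix are often equal only
   up to a propositional equality; for m = n this is invertibility in the ring
   of square matrices. *)
Definition is_mxinverse (R : pzRingType) (m n : nat)
    (A : 'M[R]_(m, n)) (B : 'M[R]_(n, m)) : Prop :=
  A *m B = 1%:M /\ B *m A = 1%:M.

Definition mxinvertible (R : pzRingType) (m n : nat) (A : 'M[R]_(m, n)) : Prop :=
  exists B : 'M[R]_(n, m), is_mxinverse A B.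

(* The unique inverse of A when there is one, and 0 otherwise. *)
Definition mxinv (R : pzRingType) (m n : nat) (A : 'M[R]_(m, n)) : 'M[R]_(n, m) :=
  xget 0 (fun B => is_mxinverse A B).

Lemma mxinvP (R : pzRingType) (m n : nat) (A : 'M[R]_(m, n)) :
  mxinvertible A -> is_mxinverse A (mxinv A).
Proof. by case=> B AB; apply: (xgetPex 0); exists B. Qed.

Lemma mxinv_eq (R : pzRingType) (m n : nat) (A : 'M[R]_(m, n))
    (B : 'M[R]_(n, m)) : is_mxinverse A B -> mxinv A = B.
Proof.
move=> [AB BA]; have [//|_ CA] := @mxinvP R m n A; first by exists B.
by rewrite -[mxinv A]mulmx1 -AB mulmxA CA mul1mx.
Qed.

Section Shift.
Context (n v r : nat) (le_vr : (v + r <= n)%N).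

Fact shift_ord_subproof (a : 'I_r) : (v + a < n)%N.
Proof. by apply: leq_trans le_vr; rewrite ltn_add2l. Qed.

Definition shift_ord (a : 'I_r) : 'I_n := Ordinal (shift_ord_subproof a).
End Shift.

(* M^{(v,w)}_{[r]}, with v and w counted from 0. *)
Definition block_submx (R : pzRingType) (n : nat) (s : 'I_n -> nat)
    (M : 'M[R]_(\sum_i s i)) (v w r : nat)
    (hv : (v + r <= n)%N) (hw : (w + r <= n)%N) :
    'M[R]_(\sum_(a < r) s (shift_ord hv a), \sum_(b < r) s (shift_ord hw b)) :=
  \mxblock_(a < r, b < r) submxblock M (shift_ord hv a) (shift_ord hw b).

(* Here H has r = q.+1 block rows and columns, both counted from 0: its block
   (a, b) is A_{a,b+1}, so p a = t_a and c b = t_{b+1}.  For q = 0 the middle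
   factors have an empty dimension, the product is 0 and |H| = A_{01}. *)
Definition hess_qdet (R : pzRingType) (q : nat) (p c : 'I_q.+1 -> nat)
    (H : 'M[R]_(\sum_a p a, \sum_b c b)) : 'M[R]_(p ord0, c ord_max) :=
  submxblock H ord0 ord_max -
  (\mxrow_(b < q) submxblock H ord0 (widen_ord (leqnSn q) b)) *m
  mxinv (\mxblock_(a < q, b < q)
           submxblock H (lift ord0 a) (widen_ord (leqnSn q) b)) *m
  (\mxcol_(a < q) submxblock H (lift ord0 a) ord_max).

Section HessSubmx.
Context (n : nat) (j k : 'I_n) (lt_jk : (j < k)%N).

Fact hess_size : (k - j)%N = (k - j).-1.+1.
Proof. by rewrite prednK // subn_gt0. Qed.

Fact hess_row_le : (j + (k - j).-1.+1 <= n)%N.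
Proof. by rewrite -hess_size subnKC ltnW. Qed.

Fact hess_col_le : (j.+1 + (k - j).-1.+1 <= n)%N.
Proof. by rewrite -hess_size addSn subnKC // ltnW. Qed.

Fact hess_row0 : shift_ord hess_row_le ord0 = j.
Proof. by apply: val_inj; rewrite /= addn0. Qed.

Fact hess_col_max : shift_ord hess_col_le ord_max = k.
Proof. by apply: val_inj; rewrite /= addSn -addnS -hess_size subnKC // ltnW. Qed.
End HessSubmx.

(* |M^{(j,j+1)}_{[k-j]}|; the cast only identifies the sizes of its first block
   row and last block column with s j and s k. *)
Definition hess_qdet_block (R : pzRingType) (n : nat) (s : 'I_n -> nat)
    (M : 'M[R]_(\sum_i s i)) (j k : 'I_n) (lt_jk : (j < k)%N) :
    'M[R]_(s j, s k) :=
  castmx (congr1 s (hess_row0 lt_jk), congr1 s (hess_col_max lt_jk))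
    (hess_qdet (block_submx M (hess_row_le lt_jk) (hess_col_le lt_jk))).

(* Main.v *)
Require Import Defs.
From mathcomp Require Import all_boot all_algebra.
From mathcomp Require Import boolp zify.

Set Implicit Arguments.
Unset Strict Implicit.
Unset Printing Implicit Defensive.

Import GRing.Theory.
Local Open Scope ring_scope.

(** Write D for the block diagonal part of M.  Then D^-1 M = 1 - Y with Y
    strictly block upper triangular.  Multiplication shifts the vanishing range
    further above the diagonal ([blk_upperM]), so Y ^+ n = 0 and the geometric
    sum of the powers of Y inverts 1 - Y on both sides.  This gives an inverse
    N of M which is again block upper triangular ([blk_upper_inverse]).

    The formula is read off the block equations of N M = 1 and M N = 1.  Because
    both factors are block upper triangular, the (a, b) entry of a product only
    involves the block indices from a to b.  Hence N_kk inverts M_kk, and the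
    window of N with indices strictly between j and k inverts the same window
    of M ([window_inverse]): it is the middle factor E of the
    quasideterminant.  The blocks (j, b) of N M with j < b < k say that the row
    (N_jb)_b is - N_jj times (M_jb)_b times E, and substituting this in the
    block (j, k) of N M yields N_jk ([inverse_block_schur]). *)

(** * Blocks of products *)

Section BlockUpper.
Context (R : pzRingType) (n : nat) (s : 'I_n -> nat).
Local Notation m := (\sum_i s i)%N.
Implicit Types (A B M N : 'M[R]_m).

Lemma submxblockM A B j k :
  submxblock (A *m B) j k = \sum_i submxblock A j i *m submxblock B i k.
Proof. by rewrite -{1}(submxblockK A) -{1}(submxblockK B) mul_mxblock mxblockK. Qed.

Lemma submxblock1_diag k : submxblock (1%:M : 'M[R]_m) k k = 1%:M.
Proof. by rewrite -mxdiagZ submxblock_diag. Qed.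

Lemma submxblock1_offdiag (j k : 'I_n) :
  j != k -> submxblock (1%:M : 'M[R]_m) j k = 0.
Proof. by move=> /negbTE jk; rewrite -mxdiagZ mxblockK jk. Qed.

(** The offset t makes the notion multiplicative: t = 0 is block upper
    triangularity, t = 1 its strict form, and only the zero matrix has
    offset n. *)
Definition blk_upper (t : nat) A : Prop :=
  forall j k : 'I_n, (k < j + t)%N -> submxblock A j k = 0.

Lemma blk_upperM t u A B :
  blk_upper t A -> blk_upper u B -> blk_upper (t + u) (A *m B).
Proof.
move=> hA hB j k lt_k; rewrite submxblockM big1 // => i _.
have [lt_i|le_i] := ltnP i (j + t); first by rewrite hA // mul0mx.
by rewrite hB ?mulmx0 //; lia.
Qed.

Lemma blk_upper1 : blk_upper 0 1%:M.
Proof.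
by move=> j k lt_kj; rewrite submxblock1_offdiag // -val_eqE /=; lia.
Qed.

Lemma blk_upperX t A : blk_upper t A -> forall i, blk_upper (i * t) (A ^+ i).
Proof.
move=> hA; elim=> [|i IH]; first exact: blk_upper1.
by rewrite exprS; exact: blk_upperM.
Qed.

Lemma blk_upperW t A : blk_upper t A -> blk_upper 0 A.
Proof. by move=> hA j k lt_kj; apply: hA; lia. Qed.

Lemma blk_upper_nilpotent A : blk_upper 1 A -> A ^+ n = 0.
Proof.
move=> /blk_upperX/(_ n); rewrite muln1 => hA.
apply/mxblockP => j k; rewrite submxblock0 hA //.
by have := ltn_ord k; lia.
Qed.

Lemma blk_upper_sum q (F : 'I_q -> 'M[R]_m) t :
  (forall i, blk_upper t (F i)) -> blk_upper t (\sum_i F i).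
Proof.
by move=> hF j k lt_k; rewrite submxblock_sum big1 // => i _; exact: hF.
Qed.

Lemma blk_upper_mxdiag (F : forall i, 'M[R]_(s i)) : blk_upper 0 (mxdiag F).
Proof.
move=> j k lt_kj; rewrite mxblockK ifF //.
by apply/negbTE; rewrite -val_eqE /=; lia.
Qed.

(** For block upper triangular factors the diagonal blocks multiply
    separately, every other term of the block sum having a factor below the
    diagonal. *)
Lemma submxblockM_diag A B k : blk_upper 0 A -> blk_upper 0 B ->
  submxblock (A *m B) k k = submxblock A k k *m submxblock B k k.
Proof.
move=> hA hB; rewrite submxblockM (bigD1 k) //= big1 ?addr0 // => i.
rewrite -val_eqE /= neq_ltn => /orP[lt|gt]; first by rewrite hA ?mul0mx //; lia.
by rewrite hB ?mulmx0 //; lia.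
Qed.

(** * The inverse of a block upper triangular matrix *)

Lemma geometric_inverse A : blk_upper 1 A ->
  is_mxinverse (1%:M - A) (\sum_(i < n) A ^+ i).
Proof.
move=> hA; set S : 'M[R]_m := \sum_(i < n) A ^+ i.
have An := blk_upper_nilpotent hA.
have S1 : (1%:M - A) *m S = 1%:M.
  have := subrX1 A n; rewrite An sub0r -(opprB 1 A) mulNr => /oppr_inj.
  exact: esym.
split=> //; rewrite -[RHS]S1 mulmxBr mulmxBl mulmx1 mul1mx; congr (_ - _).
by apply/commr_sym/commr_sum => i _; exact/commrX.
Qed.

Lemma blk_upper_inverse M : blk_upper 0 M ->
  (forall k, mxinvertible (submxblock M k k)) ->
  exists2 N, is_mxinverse M N & blk_upper 0 N.
Proof.
move=> hM dM; pose D' := mxdiag (fun k => mxinv (submxblock M k k)).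
pose D := mxdiag (fun k => submxblock M k k).
have DD' : D *m D' = 1%:M.
  rewrite /D' [X in _ *m X]/mxdiag mul_mxdiag_mxblock.
  rewrite -mxdiagZ; apply: eq_mxblock => j k.
  case: eqVneq => [->|_]; rewrite ?mulmx0 //.
  by rewrite !conform_mx_id; case: (mxinvP (dM k)).
have D'u : blk_upper 0 D' by exact: blk_upper_mxdiag.
have Yu : blk_upper 1 (1%:M - D' *m M).
  move=> j k lt_k; rewrite submxblockB.
  have [->|ne_jk] := eqVneq j k.
    rewrite submxblock1_diag submxblockM_diag // submxblock_diag.
    by have [_ ->] := mxinvP (dM k); rewrite subrr.
  have lt_kj : (k < j + (0 + 0))%N by move: ne_jk; rewrite -val_eqE /=; lia.
  by rewrite submxblock1_offdiag // (blk_upperM D'u hM) // subr0.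
have [] := geometric_inverse Yu; set S : 'M[R]_m := \sum_(i < n) _ ^+ i.
rewrite subKr => MS SM.
have Su : blk_upper 0 S.
  by apply: blk_upper_sum => i; exact/blk_upperW/blk_upperX/Yu.
exists (S *m D'); last exact: (blk_upperM Su D'u).
split; last by rewrite -mulmxA.
by rewrite -[M]mul1mx -DD' -(mulmxA D) mulmxA -(mulmxA D) MS mulmx1 DD'.
Qed.

(** * Windows of the inverse *)

(** The increasing enumeration of the indices strictly between j and k, by
    'I_q, is represented by any bijection of 'I_q with that open interval. *)
Section Window.
Context (M N : 'M[R]_m) (hM : blk_upper 0 M) (hN : blk_upper 0 N).
Context (MN : is_mxinverse M N) (j k : 'I_n) (lt_jk : (j < k)%N).
Context (q : nat) (f : 'I_q -> 'I_n) (f_inj : injective f).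
Context (f_im : f @: [set: 'I_q] = [set i : 'I_n | (j < i < k)%N]).

Lemma window_sum (V : nmodType) (F : 'I_n -> V) :
  \sum_(i < n | (j < i < k)%N) F i = \sum_(a < q) F (f a).
Proof.
transitivity (\sum_(i in f @: [set: 'I_q]) F i).
  by apply: eq_bigl => i; rewrite f_im inE.
rewrite big_imset; last by move=> a b _ _; exact: f_inj.
by apply: eq_bigl => a; rewrite inE.
Qed.

Lemma window_mem a : (j < f a < k)%N.
Proof.
have : f a \in f @: [set: 'I_q] by apply: imset_f; rewrite inE.
by rewrite f_im inE.
Qed.

(** Passing to a window of consecutive indices is multiplicative on block upper
    triangular matrices: a path from f a to f b through an index outside the
    window has to step below the diagonal. *)
Lemma window_mul A B a b : blk_upper 0 A -> blk_upper 0 B ->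
  \sum_c submxblock A (f a) (f c) *m submxblock B (f c) (f b) =
  submxblock (A *m B) (f a) (f b).
Proof.
move=> hA hB; have /andP[ja ak] := window_mem a; have /andP[jb bk] := window_mem b.
rewrite submxblockM (bigID (fun i : 'I_n => (j < i < k)%N)) /=.
rewrite -(window_sum (fun i => submxblock A (f a) i *m submxblock B i (f b))).
rewrite [X in _ + X]big1 ?addr0 // => i; rewrite negb_and -!leqNgt => /orP[le|ge].
  by rewrite hA ?mul0mx //; lia.
by rewrite hB ?mulmx0 //; lia.
Qed.

Lemma window1 :
  \mxblock_(a < q, b < q) submxblock (1%:M : 'M[R]_m) (f a) (f b) = 1%:M.
Proof.
rewrite -[RHS]mxdiagZ; apply: eq_mxblock => a b; case: eqVneq => [->|ne].
  by rewrite submxblock1_diag conform_mx_id.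
by rewrite submxblock1_offdiag // (inj_eq f_inj).
Qed.

Lemma window_inverse :
  is_mxinverse (\mxblock_(a < q, b < q) submxblock M (f a) (f b))
               (\mxblock_(a < q, b < q) submxblock N (f a) (f b)).
Proof.
have [MN1 NM1] := MN.
by split; rewrite mul_mxblock -window1; apply: eq_mxblock => a b;
  rewrite window_mul // ?MN1 ?NM1.
Qed.

(** Separating the two ends j and k from the window isolates the term
    N_jk M_kk that the block equation of N M = 1 is solved for. *)
Lemma submxblockM_ends A B (b : 'I_n) : blk_upper 0 A -> blk_upper 0 B ->
  (j < b <= k)%N ->
  submxblock (A *m B) j b = submxblock A j j *m submxblock B j b
    + \sum_(c < q) submxblock A j (f c) *m submxblock B (f c) b
    + submxblock A j k *m submxblock B k b.
Proof.
move=> hA hB /andP[lt_jb le_bk].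
rewrite submxblockM (bigD1 j) //= (bigD1 k) /=; last by rewrite -val_eqE /=; lia.
rewrite -(window_sum (fun i => submxblock A j i *m submxblock B i b)).
rewrite -addrA [X in _ = _ + X]addrC; congr (_ + (_ + _)).
rewrite [LHS](bigID (fun i : 'I_n => (j < i < k)%N)) /=.
rewrite [X in _ + X]big1 ?addr0.
  apply: eq_bigl => i; rewrite andbC; case: (boolP (_ < _ < _)%N) => // /andP[ji ik].
  by rewrite -!val_eqE /=; lia.
move=> i; rewrite -!val_eqE /= => out.
have [lt_ij|le_ji] := ltnP i j; first by rewrite hA ?mul0mx //; lia.
by rewrite hB ?mulmx0 //; lia.
Qed.

Lemma inverse_block_schur :
  submxblock N j k = - submxblock N j j *m
    (submxblock M j k -
     (\mxrow_(b < q) submxblock M j (f b)) *m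
     mxinv (\mxblock_(a < q, b < q) submxblock M (f a) (f b)) *m
     (\mxcol_(a < q) submxblock M (f a) k)) *m submxblock N k k.
Proof.
have [MN1 NM1] := MN; have Winv := window_inverse.
rewrite (mxinv_eq Winv); case: Winv => WE _.
set Wd := mxblock _ in WE *; set E := mxblock _ in WE *.
set r := mxrow _; set c := mxcol _.
pose u := \mxrow_(b < q) submxblock N j (f b).
(* The blocks (j, b) of N M = 1 for b in the window. *)
have uW : u *m Wd = - (submxblock N j j *m r).
  rewrite mul_mxrow_mxblock mul_mxrow -mxrowN; apply: eq_mxrow => b.
  have /andP[jb bk] := window_mem b.
  have := submxblockM_ends hN hM (b := f b); rewrite jb (ltnW bk) => /(_ isT).
  rewrite NM1 submxblock1_offdiag; last by rewrite -val_eqE /=; lia.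
  rewrite [submxblock M k _]hM ?mulmx0 ?addr0; last by lia.
  by move=> /esym/eqP; rewrite addrC addr_eq0 => /eqP.
have uE : u = - (submxblock N j j *m r *m E).
  by rewrite -mulNmx -uW -mulmxA WE mulmx1.
have Mk : submxblock M k k *m submxblock N k k = 1%:M.
  by rewrite -submxblockM_diag // MN1 submxblock1_diag.
(* The block (j, k) of N M = 1, solved for N_jk. *)
have := submxblockM_ends hN hM (b := k); rewrite lt_jk leqnn => /(_ isT).
rewrite NM1 submxblock1_offdiag; last by rewrite -val_eqE /=; lia.
rewrite -mul_mxrow_mxcol -/u -/c uE => /esym/eqP; rewrite addrC addr_eq0 => /eqP e.
rewrite -[LHS]mulmx1 -Mk mulmxA e; congr (_ *m _).
by rewrite mulNmx mulmxBr !mulmxA mulNmx.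
Qed.
End Window.

(** * The quasideterminant of a window *)

(** The row window f and the column window g of the submatrix of M starting at
    block (j, j + 1) have the same values but are different terms, and so are
    the corner indices j' and k'; they are identified here, which removes the
    cast. *)
Lemma inverse_block_cast M N (j k j' k' : 'I_n) (ej : j' = j) (ek : k' = k)
    (q : nat) (f g : 'I_q -> 'I_n) :
  blk_upper 0 M -> blk_upper 0 N -> is_mxinverse M N -> (j < k)%N ->
  f =1 g -> injective f -> f @: [set: 'I_q] = [set i : 'I_n | (j < i < k)%N] ->
  submxblock N j k = - submxblock N j j *m
    castmx (congr1 s ej, congr1 s ek)
    (submxblock M j' k' -
     (\mxrow_(b < q) submxblock M j' (g b)) *m
     mxinv (\mxblock_(a < q, b < q) submxblock M (f a) (g b)) *m
     (\mxcol_(a < q) submxblock M (f a) k')) *m submxblock N k k.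
Proof.
move=> hM hN MN lt_jk /funext fg; subst g j' k'; rewrite castmx_id => f_inj f_im.
exact: inverse_block_schur.
Qed.

Lemma inverse_block_hess M N (j k : 'I_n) (lt_jk : (j < k)%N) :
  blk_upper 0 M -> blk_upper 0 N -> is_mxinverse M N ->
  submxblock N j k =
    - submxblock N j j *m hess_qdet_block M lt_jk *m submxblock N k k.
Proof.
move=> hM hN MN; rewrite /hess_qdet_block /hess_qdet /block_submx.
rewrite mxblockK.
under eq_mxrow do rewrite mxblockK.
under eq_mxcol do rewrite mxblockK.
under eq_mxblock do rewrite mxblockK.
apply: (@inverse_block_cast M N j k _ _ _ _ _
  (fun a => shift_ord (hess_row_le lt_jk) (lift ord0 a)) 
  (fun b => shift_ord (hess_col_le lt_jk) (widen_ord (leqnSn _) b))) => //.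
- by move=> a; apply: val_inj; rewrite /= /bump /=; lia.
- move=> a b /(congr1 (@nat_of_ord n)); rewrite /= /bump /= => e.
  by apply: val_inj => /=; lia.
apply/setP => i; rewrite inE; apply/imsetP/idP => [[[a lt_a] _ ->]|/andP[ji ik]].
  by move: lt_a; rewrite /= /bump /=; lia.
have lt_a : (i - j.+1 < (k - j).-1)%N by lia.
by exists (Ordinal lt_a); rewrite ?inE //; apply: val_inj; rewrite /= /bump /=; lia.
Qed.

End BlockUpper.

Theorem theorem3p1 (R : pzRingType) (n : nat) (n_gt0 : (0 < n)%N)
    (s : 'I_n -> nat) (s_gt0 : forall j : 'I_n, (0 < s j)%N)
    (M : 'M[R]_(\sum_j s j))
    (M_triu : forall j k : 'I_n, (k < j)%N -> submxblock M j k = 0)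
    (M_diag : forall k : 'I_n, mxinvertible (submxblock M k k)) :
  mxinvertible M /\
  [/\ (forall (j k : 'I_n) (lt_jk : (j < k)%N),
         submxblock (mxinv M) j k =
           - mxinv (submxblock M j j) *m hess_qdet_block M lt_jk
             *m mxinv (submxblock M k k)),
      (forall k : 'I_n, submxblock (mxinv M) k k = mxinv (submxblock M k k))
    & (forall j k : 'I_n, (k < j)%N -> submxblock (mxinv M) j k = 0)].
Proof.
have hM : blk_upper 0 M by move=> j k; rewrite addn0; exact: M_triu.
have [N MN hN] := blk_upper_inverse hM M_diag.
have Nd k : mxinv (submxblock M k k) = submxblock N k k.
  have [MN1 NM1] := MN; apply: mxinv_eq.
  by split; rewrite -submxblockM_diag // ?MN1 ?NM1 submxblock1_diag.
split; first by exists N.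
rewrite (mxinv_eq MN); split=> [j k lt_jk|k|j k lt_kj].
- by rewrite !Nd; exact: inverse_block_hess.
- by rewrite Nd.
- by apply: hN; rewrite addn0.
Qed.
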